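(* Let $M,K,N,R$ be positive integers and let the real numbers $a_{m,k}\ge 0$, $c_{m,i,k}\ge 0$, $d_k\ge 0$, $e_{m,k}\ge 0$, $f_m\ge 0$, the complex numbers $b_{m,i,k}$, and the constants $\sigma_{\mathrm d}^2>0$ and $P_{\mathrm d}>0$ be as defined in the context (for $m\in\{1,\dots,M\}$ and $i,k\in\{1,\dots,K\}$). Consider the optimization problem in the real variables $x_{m,k}$ ($1\le m\le M$, $1\le k\le K$) and $y_{i,k}$ ($1\le i,k\le K$, $i\ne k$): $$\max_{\{x_{m,k},\,y_{i,k}\}}\ \min_{k\in\{1,\dots,K\}}\ \frac{\left(\sum_{m=1}^{M}a_{m,k}x_{m,k}\right)^{2}}{\sum_{i\neq k}y_{i,k}^{2}+\sum_{m=1}^{M}\sum_{i=1}^{K}c_{m,i,k}x_{m,i}^{2}+d_{k}+\sigma_{\mathrm d}^{2}}$$ subject to $$\sum_{k=1}^{K}e_{m,k}x_{m,k}^{2}+f_{m}\le P_{\mathrm d}\quad (1\le m\le M),$$ $$\left|\sum_{m=1}^{M}b_{m,i,k}x_{m,i}\right|\le y_{i,k}\quad (1\le i,k\le K,\ i\ne k),$$ $$x_{m,k}\ge 0\quad (1\le m\le M,\ 1\le k\le K).$$ Then this is a quasiconcave optimization problem, i.e. it is the maximization of a quasiconcave objective function over a convex feasible set.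
   Context: Data. $\rho_{\mathrm d}\in[0,1)$ is a constant; for each $m\in\{1,\dots,M\}$ and $k\in\{1,\dots,K\}$, $\hat{\mathbf g}_{m,k}\in\mathbb C^{R}$ is a fixed vector (channel estimate), $\mathbf C_{\tilde{\mathbf g}_{m,k}}\in\mathbb C^{R\times R}$ is a fixed Hermitian nonnegative definite matrix (channel estimation error covariance), $\mathbf W_m\in\mathbb C^{N\times R}$ is a fixed matrix (RF precoder), and $\sigma_{\mathrm d,m}\ge 0$ is a fixed real number. $\mathrm{diag}(\mathbf A)$ denotes the diagonal matrix with the same diagonal entries as $\mathbf A$. The coefficients are $$a_{m,k}=(1-\rho_{\mathrm d})\|\hat{\mathbf g}_{m,k}\|^2,\qquad b_{m,i,k}=(1-\rho_{\mathrm d})\hat{\mathbf g}_{m,k}^{\mathrm H}\hat{\mathbf g}_{m,i},$$ $$c_{m,i,k}=(1-\rho_{\mathrm d})^{2}\hat{\mathbf g}_{m,i}^{\mathrm H}\mathbf C_{\tilde{\mathbf g}_{m,k}}\hat{\mathbf g}_{m,i}+\rho_{\mathrm d}(1-\rho_{\mathrm d})\,\mathrm{tr}\big((\hat{\mathbf g}_{m,k}\hat{\mathbf g}_{m,k}^{\mathrm H}+\mathbf C_{\tilde{\mathbf g}_{m,k}})\,\mathrm{diag}(\hat{\mathbf g}_{m,i}\hat{\mathbf g}_{m,i}^{\mathrm H})\big),$$ $$d_k=\sum_{m=1}^M(1-\rho_{\mathrm d})\,\mathrm{tr}\big(\hat{\mathbf g}_{m,k}\hat{\mathbf g}_{m,k}^{\mathrm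 H}+\mathbf C_{\tilde{\mathbf g}_{m,k}}\big)\sigma_{\mathrm d,m}^2,$$ $$e_{m,k}=(1-\rho_{\mathrm d})^{2}\|\mathbf W_m\hat{\mathbf g}_{m,k}\|^2+\rho_{\mathrm d}(1-\rho_{\mathrm d})\,\mathrm{tr}\big(\mathbf W_m\mathrm{diag}(\hat{\mathbf g}_{m,k}\hat{\mathbf g}_{m,k}^{\mathrm H})\mathbf W_m^{\mathrm H}\big),\qquad f_m=(1-\rho_{\mathrm d})\,\mathrm{tr}(\mathbf W_m\mathbf W_m^{\mathrm H})\sigma_{\mathrm d,m}^2.$$ A function is quasiconcave on a convex set if all its superlevel sets $\{z: f(z)\ge t\}$ in that set, $t\in\mathbb R$, are convex; here quasiconcavity of the objective is understood on the domain $x_{m,k}\ge 0$ imposed by the last constraint. *)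

(* Defs.v *)
From HB Require Import structures.
From mathcomp Require Import all_boot all_order all_algebra.
From mathcomp Require Import sesquilinear spectral complex.
From mathcomp Require Import classical_sets reals convex.

Set Implicit Arguments.
Unset Strict Implicit.
Unset Printing Implicit Defensive.

Import Order.TTheory GRing.Theory Num.Theory.

Local Open Scope ring_scope.
Local Open Scope complex_scope.
Local Open Scope sesquilinear_scope.
Local Open Scope classical_set_scope.

Section Quasiconcave.
Variables (R : realType) (E : lmodType R).

Definition quasiconcave_on (D : set E) (f : E -> R) : Prop :=
  convex_set D /\ forall t : R, convex_set (D `&` [set z | t <= f z]).

(* The problem "maximize f over S", the objective f having domain D. *)
Definition quasiconcave_maximization (D : set E) (f : E -> R) (S : set E) :
    Prop :=
  [/\ S `<=` D, quasiconcave_on D f & convex_set S].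

End Quasiconcave.

Section ComplexMatrices.
Variable R : realType.

Definition cnorm (z : R[i]) : R :=
  Num.sqrt (complex.Re z ^+ 2 + complex.Im z ^+ 2).

Definition vnorm n (v : 'cV[R[i]]_n) : R :=
  Num.sqrt (\sum_(j < n) cnorm (v j 0) ^+ 2).

(* [0 <= w] in R[i] means that w is real and nonnegative. *)
Definition nonneg_definite n (A : 'M[R[i]]_n) : Prop :=
  A \is hermsymmx /\ forall v : 'cV_n, 0 <= (v ^t* *m A *m v) 0 0.

Definition diag_part n (A : 'M[R[i]]_n) : 'M[R[i]]_n := diag_mx (\row_j A j j).

Lemma cnormE (z : R[i]) : (cnorm z)%:C = `|z|.
Proof. by rewrite normc_def. Qed.

Lemma mul_trmxC_ge0 n p (A : 'M[R[i]]_(n, p)) j : 0 <= (A *m A ^t*) j j.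
Proof.
by rewrite mxE sumr_ge0 // => l _; rewrite !mxE mul_conjC_ge0.
Qed.

Lemma nonneg_definite_diag n (A : 'M[R[i]]_n) j :
  nonneg_definite A -> 0 <= A j j.
Proof.
pose v : 'cV[R[i]]_n := delta_mx j 0.
move=> [_ /(_ v)]; suff -> : (v ^t* *m A *m v) 0 0 = A j j by [].
have -> : v ^t* = delta_mx 0 j.
  by rewrite trmx_delta map_delta_mx.
by rewrite -rowE -colE !mxE.
Qed.

(* The coefficients below take real parts of quadratic forms and traces; by the
   following lemmas these complex numbers are real, so nothing is dropped. *)
Lemma quad_real n (A : 'M[R[i]]_n) (v : 'cV_n) : nonneg_definite A ->
  (complex.Re ((v ^t* *m A *m v) 0 0))%:C = (v ^t* *m A *m v) 0 0.
Proof. by move=> [_ Av]; rewrite RRe_real // ger0_real. Qed.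

Lemma tr_cov_real n (A : 'M[R[i]]_n) (g : 'cV_n) : nonneg_definite A ->
  (complex.Re (\tr (g *m g ^t* + A)))%:C = \tr (g *m g ^t* + A).
Proof.
move=> nA; rewrite RRe_real // ger0_real // /mxtrace sumr_ge0 // => j _.
by rewrite mxE addr_ge0 ?mul_trmxC_ge0 ?nonneg_definite_diag.
Qed.

Lemma tr_cov_diag_real n (A : 'M[R[i]]_n) (g h : 'cV_n) : nonneg_definite A ->
  (complex.Re (\tr ((g *m g ^t* + A) *m diag_part (h *m h ^t*))))%:C
  = \tr ((g *m g ^t* + A) *m diag_part (h *m h ^t*)).
Proof.
move=> nA; rewrite RRe_real // ger0_real // /mxtrace sumr_ge0 // => j _.
rewrite mul_mx_diag !mxE mulr_ge0 //; last first.
  by have := mul_trmxC_ge0 h j; rewrite mxE.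
have := addr_ge0 (mul_trmxC_ge0 g j) (nonneg_definite_diag j nA).
by rewrite mxE.
Qed.

Lemma tr_precoder_diag_real n p (W : 'M[R[i]]_(p, n)) (g : 'cV_n) :
  (complex.Re (\tr (W *m diag_part (g *m g ^t*) *m W ^t*)))%:C
  = \tr (W *m diag_part (g *m g ^t*) *m W ^t*).
Proof.
rewrite RRe_real // ger0_real // /mxtrace sumr_ge0 // => j _.
rewrite mul_mx_diag mxE sumr_ge0 // => l _.
rewrite !mxE mulrAC mulr_ge0 ?mul_conjC_ge0 //.
by have := mul_trmxC_ge0 g l; rewrite mxE.
Qed.

Lemma tr_precoder_real n p (W : 'M[R[i]]_(p, n)) :
  (complex.Re (\tr (W *m W ^t*)))%:C = \tr (W *m W ^t*).
Proof.
rewrite RRe_real // ger0_real // /mxtrace sumr_ge0 // => j _.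
exact: mul_trmxC_ge0.
Qed.

End ComplexMatrices.

(* Index set of the variables y: the ordered pairs (i, k) with i != k. *)
Definition offdiag (K : nat) := {p : 'I_K * 'I_K | p.1 != p.2}.

Section Problem.
Variables (R : realType) (M K N L : nat).
(* L is the dimension of the channel vectors, R being taken by the reals;
   [g m k] is the channel estimate, [C m k] the error covariance, [W m] the RF
   precoder. *)
Variables (rho : R) (g : 'I_M -> 'I_K -> 'cV[R[i]]_L)
  (C : 'I_M -> 'I_K -> 'M[R[i]]_L) (W : 'I_M -> 'M[R[i]]_(N, L))
  (sigma_m : 'I_M -> R).

Definition coef_a m k : R := (1 - rho) * vnorm (g m k) ^+ 2.

Definition coef_b m i k : R[i] :=
  (1 - rho)%:C * ((g m k) ^t* *m g m i) 0 0.

Definition coef_c m i k : R :=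
  (1 - rho) ^+ 2 * complex.Re (((g m i) ^t* *m C m k *m g m i) 0 0)
  + rho * (1 - rho)
    * complex.Re (\tr ((g m k *m (g m k) ^t* + C m k)
                       *m diag_part (g m i *m (g m i) ^t*))).

Definition coef_d k : R :=
  \sum_(m < M) (1 - rho) * complex.Re (\tr (g m k *m (g m k) ^t* + C m k))
               * sigma_m m ^+ 2.

Definition coef_e m k : R :=
  (1 - rho) ^+ 2 * vnorm (W m *m g m k) ^+ 2
  + rho * (1 - rho)
    * complex.Re (\tr (W m *m diag_part (g m k *m (g m k) ^t*) *m (W m) ^t*)).

Definition coef_f m : R :=
  (1 - rho) * complex.Re (\tr (W m *m (W m) ^t*)) * sigma_m m ^+ 2.

Definition vars : lmodType R := ('M[R]_(M, K) * {ffun offdiag K -> R^o})%type.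

Variables (sigma_d P_d : R).

Definition sinr (z : vars) (k : 'I_K) : R :=
  (\sum_(m < M) coef_a m k * z.1 m k) ^+ 2
  / (\sum_(p : offdiag K | (val p).2 == k) z.2 p ^+ 2
     + \sum_(m < M) \sum_(i < K) coef_c m i k * z.1 m i ^+ 2
     + coef_d k + sigma_d ^+ 2).

(* The minimum over k is started at the SINR of the first user. *)
Definition objective (K_gt0 : (0 < K)%N) (z : vars) : R :=
  \big[Num.min/sinr z (Ordinal K_gt0)]_(k < K) sinr z k.

Definition domain : set vars := [set z : vars | forall m k, 0 <= z.1 m k].

Definition feasible : set vars :=
  [set z : vars |
    [/\ forall m, \sum_(k < K) coef_e m k * z.1 m k ^+ 2 + coef_f m <= P_d,
        forall p : offdiag K,
          cnorm (\sum_(m < M) coef_b m (val p).1 (val p).2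
                              * (z.1 m (val p).1)%:C) <= z.2 p
      & forall m k, 0 <= z.1 m k]].

End Problem.

(* Main.v *)
(* The numerator of each SINR is the square of a nonnegative linear function A,
   and its denominator B is a nonnegative combination of squares of coordinates
   plus a positive constant. For t > 0 the superlevel set A^2 / B >= t is the set
   B / A <= A / t, which is convex because u^2 / a is jointly convex in (u, a)
   for a > 0; this avoids square roots and Cauchy-Schwarz. A minimum of
   quasiconcave functions is quasiconcave, and the feasible set is convex since
   its constraints bound convex functions by linear ones. *)
Require Import Defs.
From mathcomp Require Import all_boot all_order all_algebra.
From mathcomp Require Import complex classical_sets reals.
From mathcomp Require Import sesquilinear spectral convex interval_inference.
From mathcomp Require Import ring lra.
Import Order.TTheory GRing.Theory Num.Theory.
Local Open Scope ring_scope.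
Local Open Scope convex_scope.

(** The endpoints of a segment are trivial, so only strictly positive weights matter; plain linear
    combinations replace [<| |>]. *)
Lemma convex_set_lin {R : realType} {E : lmodType R} (A : set E) :
  (forall (x y : E) (l r : R), 0 < l -> 0 < r -> l + r = 1 ->
     A x -> A y -> A (l *: x + r *: y)) ->
  convex_set A.
Proof.
move=> hA; apply/convex_setW => x y xA yA k k0 k1; rewrite inE.
apply: hA; rewrite -?[A _]inE //.
  by rewrite subr_gt0.
by rewrite addrC subrK.
Qed.

Lemma convex_setD {R : realType} {E : lmodType R} (A : set E) (x y : E)
    (l r : R) :
  convex_set A -> 0 <= l -> 0 <= r -> l + r = 1 -> A x -> A y ->
  A (l *: x + r *: y).
Proof.
move=> cA l0 r0 lr Ax Ay.
have l1 : l <= 1 by rewrite -lr lerDl.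
have := cA x y (Itv01 l0 l1); rewrite !inE => /(_ Ax Ay).
by rewrite (_ : r = 1 - l) // -lr addrC addKr.
Qed.

Lemma Re_ge0 {R : realType} (z : R[i]) : 0 <= z -> 0 <= complex.Re z.
Proof. by rewrite lecE => /andP[]. Qed.

Lemma cnorm_convex {R : realType} (z w : R[i]) (l r : R) :
  0 <= l -> 0 <= r ->
  cnorm (l%:C%C * z + r%:C%C * w) <= l * cnorm z + r * cnorm w.
Proof.
move=> l0 r0; rewrite -lecR rmorphD !rmorphM /= !cnormE.
apply: le_trans (ler_normD _ _) _.
by rewrite !normrM (ger0_norm (x := l%:C%C)) ?(ger0_norm (x := r%:C%C)) ?lecR.
Qed.

Local Open Scope sesquilinear_scope.

(** The trace is the sum of the products [A j j * B j j], so only the diagonals count. *)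
Lemma tr_mul_diag_part_ge0 {R : realType} n (A B : 'M[R[i]]_n) :
  (forall j, 0 <= A j j) -> (forall j, 0 <= B j j) ->
  0 <= \tr (A *m diag_part B).
Proof.
move=> A0 B0; rewrite /mxtrace sumr_ge0 // => j _.
by rewrite mul_mx_diag !mxE mulr_ge0.
Qed.

Lemma cov_diag_ge0 {R : realType} n (A : 'M[R[i]]_n) (g : 'cV[R[i]]_n) j :
  nonneg_definite A -> 0 <= (g *m g ^t* + A) j j.
Proof.
by move=> nA; rewrite mxE addr_ge0 ?mul_trmxC_ge0 ?nonneg_definite_diag.
Qed.

(* Instances: [p = l], [q = r] with [l + r = 1] is the convexity of [u^2];
   [p = l a / x], [q = r a / y] with [a = l x + r y] is the convexity of the
   quadratic-over-linear function [u^2 / x]. Being linear in [p, q], the bound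
   passes to sums of squares. *)
Definition sqr_bound {R : realType} (l r p q : R) :=
  forall u v : R, (l * u + r * v) ^+ 2 <= p * u ^+ 2 + q * v ^+ 2.

(** The gap between the two sides is [(y * u - x * v) ^+ 2] times a positive factor. *)
Lemma sqr_bound_perspective {R : realType} (l r x y : R) :
  0 < l -> 0 < r -> 0 < x -> 0 < y ->
  sqr_bound l r (l * (l * x + r * y) / x) (r * (l * x + r * y) / y).
Proof.
move=> l0 r0 x0 y0 u v.
have [x1 y1] : x != 0 /\ y != 0 by rewrite !gt_eqF.
rewrite -subr_ge0.
have -> : l * (l * x + r * y) / x * u ^+ 2 + r * (l * x + r * y) / y * v ^+ 2
    - (l * u + r * v) ^+ 2 = l * r / (x * y) * (y * u - x * v) ^+ 2.
  by field; rewrite x1 y1.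
by rewrite mulr_ge0 ?sqr_ge0 // divr_ge0 // ltW // mulr_gt0.
Qed.

Lemma sqr_bound_jensen {R : realType} (l r : R) :
  0 < l -> 0 < r -> l + r = 1 -> sqr_bound l r l r.
Proof.
move=> l0 r0 lr u v; have := sqr_bound_perspective l r 1 1 l0 r0 ltr01 ltr01 u v.
by rewrite !mulr1 lr !mulr1 !divr1.
Qed.

Lemma sqr_bound_sum {R : realType} (l r p q : R) (I : finType) (P : pred I)
    (c u v : I -> R) :
  sqr_bound l r p q -> (forall i, 0 <= c i) ->
  \sum_(i | P i) c i * (l * u i + r * v i) ^+ 2 <=
  p * (\sum_(i | P i) c i * u i ^+ 2) + q * (\sum_(i | P i) c i * v i ^+ 2).
Proof.
move=> lrpq c0; rewrite !mulr_sumr -big_split ler_sum // => i _ /=.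
by rewrite !(mulrCA _ (c i)) -mulrDr ler_wpM2l.
Qed.

Section Coefficients.
Variables (R : realType) (M K N L : nat) (rho : R).
Hypotheses (rho_ge0 : 0 <= rho) (rho_lt1 : rho < 1).
Variables (g : 'I_M -> 'I_K -> 'cV[R[i]]_L) (C : 'I_M -> 'I_K -> 'M[R[i]]_L).
Hypothesis C_nonneg : forall m k, nonneg_definite (C m k).
Variables (W : 'I_M -> 'M[R[i]]_(N, L)) (sigma_m : 'I_M -> R).

Let rho'_ge0 : 0 <= 1 - rho. Proof. by rewrite subr_ge0 ltW. Qed.

Lemma coef_a_ge0 m k : 0 <= coef_a rho g m k.
Proof. by rewrite mulr_ge0 ?sqr_ge0. Qed.

Lemma coef_c_ge0 m i k : 0 <= coef_c rho g C m i k.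
Proof.
rewrite addr_ge0 ?mulr_ge0 ?sqr_ge0 ?Re_ge0 //; first by case: (C_nonneg m k).
apply: tr_mul_diag_part_ge0 => j; first exact: cov_diag_ge0.
exact: mul_trmxC_ge0.
Qed.

Lemma coef_d_ge0 k : 0 <= coef_d rho g C sigma_m k.
Proof.
rewrite sumr_ge0 // => m _; rewrite mulr_ge0 ?sqr_ge0 ?mulr_ge0 ?Re_ge0 //.
by rewrite sumr_ge0 // => j _; exact: cov_diag_ge0.
Qed.

Lemma coef_e_ge0 m k : 0 <= coef_e rho g W m k.
Proof.
rewrite addr_ge0 ?mulr_ge0 ?sqrtr_ge0 ?Re_ge0 //.
(* Cyclicity of the trace brings the diagonal factor to the right, leaving the Gram matrix of [W m]
   on its left. *)
rewrite mxtrace_mulC mulmxA; apply: tr_mul_diag_part_ge0 => j.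
  by have := mul_trmxC_ge0 ((W m) ^t*) j; rewrite trmxCK.
exact: mul_trmxC_ge0.
Qed.

End Coefficients.

(** A superlevel set of the minimum is the intersection of those of the [f z i]; the starting value
    [f z i0] is one of them and adds no constraint. *)
Lemma quasiconcave_on_bigmin {R : realType} {E : lmodType R} (D : set E)
    (I : finType) (i0 : I) (f : E -> I -> R) :
  (forall i, quasiconcave_on D (f^~ i)) ->
  quasiconcave_on D (fun z => \big[Num.min/f z i0]_i f z i).
Proof.
move=> fqc; split=> [|t]; first by case: (fqc i0).
move=> x y k; rewrite !inE => -[Dx /bigmin_geP[_ tx]] [Dy /bigmin_geP[_ ty]].
have Dt i : ((D `&` [set z | t <= f z i]) (x <| k |> y))%classic.
  have [_ /(_ t x y k)] := fqc i.
  by rewrite !inE; apply; split; rewrite /= ?tx ?ty.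
split; first by case: (Dt i0).
by apply/bigmin_geP; split=> [|i _]; [case: (Dt i0) | case: (Dt i)].
Qed.

(* The last hypothesis holds when [B] is a nonnegative constant plus a
   nonnegative combination of squares of linear forms. *)
Lemma sqr_ratio_quasiconcave {R : realType} {E : lmodType R} (D : set E)
    (A B : E -> R) :
  convex_set D ->
  (forall z, D z -> 0 <= A z) -> (forall z, 0 < B z) ->
  (forall x y (l r : R), A (l *: x + r *: y) = l * A x + r * A y) ->
  (forall x y (l r p q : R), l + r = 1 -> 0 <= p -> 0 <= q -> sqr_bound l r p q ->
     B (l *: x + r *: y) <= p * B x + q * B y) ->
  quasiconcave_on D (fun z => A z ^+ 2 / B z).
Proof.
move=> cD A0 B0 linA boundB; split=> // t.
apply: convex_set_lin => x y l r l0 r0 lr [Dx /= tx] [Dy /= ty].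
split; first by apply: convex_setD => //; exact: ltW.
rewrite /=.
move: tx ty; rewrite !ler_pdivlMr // => tx ty.
(* For [t <= 0] the left side is nonpositive and the right side a square. For [t > 0], membership in
   the superlevel set forces [A] to be positive, which allows division by it. *)
have [t0|t0] := leP t 0.
  by rewrite (le_trans _ (sqr_ge0 _)) // mulr_le0_ge0 // ltW.
have A_gt0 z : D z -> t * B z <= A z ^+ 2 -> 0 < A z.
  move=> Dz tz; rewrite lt_def A0 // andbT -sqrf_eq0 gt_eqF //.
  by apply: lt_le_trans tz; rewrite mulr_gt0.
have [Ax Ay] := (A_gt0 x Dx tx, A_gt0 y Dy ty).
rewrite linA; set a := l * A x + r * A y.
have a0 : 0 < a by rewrite addr_gt0 ?mulr_gt0.
(* These are the perspective weights at [A x] and [A y]. The perspective bound is an equality for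
   [u = A x], [v = A y], so weighting the two hypotheses [t * B <= A ^+ 2] by them yields exactly
   [a ^+ 2]. *)
have [p0 q0] : 0 <= l * a / A x /\ 0 <= r * a / A y.
  by rewrite !(divr_ge0, mulr_ge0) // ltW.
have := boundB x y l r _ _ lr p0 q0 (sqr_bound_perspective _ _ _ _ l0 r0 Ax Ay).
rewrite -(ler_pM2l t0) => /le_trans; apply.
have -> : a ^+ 2 = l * a / A x * A x ^+ 2 + r * a / A y * A y ^+ 2.
  by rewrite /a; field; rewrite !gt_eqF.
by rewrite mulrDr lerD // mulrCA ler_wpM2l.
Qed.

Lemma domain_convex {R : realType} M K : convex_set (@domain R M K).
Proof.
apply: convex_set_lin => x y l r l0 r0 _ Dx Dy m k.
by rewrite !mxE addr_ge0 // mulr_ge0 // ltW.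
Qed.

Section Problem.
Variables (R : realType) (M K N L : nat) (rho : R).
Hypotheses (rho_ge0 : 0 <= rho) (rho_lt1 : rho < 1).
Variables (g : 'I_M -> 'I_K -> 'cV[R[i]]_L) (C : 'I_M -> 'I_K -> 'M[R[i]]_L).
Hypothesis C_nonneg : forall m k, nonneg_definite (C m k).
Variables (W : 'I_M -> 'M[R[i]]_(N, L)) (sigma_m : 'I_M -> R).

Lemma sinr_quasiconcave (sigma_d : R) k : 0 < sigma_d ^+ 2 ->
  quasiconcave_on (domain (R := R) (M := M) (K := K))
    (fun z => sinr rho g C sigma_m sigma_d z k).
Proof.
move=> sigma_gt0; apply: sqr_ratio_quasiconcave => [|z Dz|z|x y l r|].
- exact: domain_convex.
- by rewrite sumr_ge0 // => m _; rewrite mulr_ge0 ?coef_a_ge0 // Dz.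
- rewrite ltr_wpDl // !addr_ge0 ?coef_d_ge0 ?sumr_ge0 // => [p _|m _].
    exact: sqr_ge0.
  by rewrite sumr_ge0 // => i _; rewrite mulr_ge0 ?sqr_ge0 ?coef_c_ge0.
- rewrite !mulr_sumr -big_split; apply: eq_bigr => m _ /=.
  by rewrite !mxE; ring.
- move=> x y l r p q lr p0 q0 lrpq.
  (* The bound at [u = v = 1]; it absorbs the constant term [s] of the denominator. *)
  have pq : 1 <= p + q by have := lrpq 1 1; rewrite !mulr1 lr !expr1n !mulr1.
  set Y := fun z : vars R M K => \sum_(j : offdiag K | (val j).2 == k) z.2 j ^+ 2.
  set X := fun z : vars R M K =>
    \sum_(m < M) \sum_(i < K) coef_c rho g C m i k * z.1 m i ^+ 2.
  set s := coef_d rho g C sigma_m k + sigma_d ^+ 2.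
  have s0 : 0 <= s by rewrite addr_ge0 ?coef_d_ge0 // ltW.
  have Yle : Y (l *: x + r *: y) <= p * Y x + q * Y y.
    rewrite /Y !mulr_sumr -big_split ler_sum // => j _ /=.
    by rewrite !ffunE; exact: lrpq.
  have Xle : X (l *: x + r *: y) <= p * X x + q * X y.
    rewrite /X !mulr_sumr -big_split ler_sum // => m _ /=.
    under eq_bigr do rewrite !mxE.
    by apply: sqr_bound_sum => // i; exact: coef_c_ge0.
  have sle : s <= (p + q) * s by rewrite ler_peMl.
  suff : Y (l *: x + r *: y) + X (l *: x + r *: y) + s <=
      p * (Y x + X x + s) + q * (Y y + X y + s) by rewrite /s !addrA.
  by lra.
Qed.

Lemma feasible_convex (P_d : R) : convex_set (feasible rho g W sigma_m P_d).
Proof.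
apply: convex_set_lin => x y l r l0 r0 lr [px bx x0] [py by_ y0].
have [lge rge] := (ltW l0, ltW r0).
split=> [m|p|m k].
- have := sqr_bound_sum _ _ _ _ _ (fun=> true) (fun k => coef_e rho g W m k)
    (x.1 m) (y.1 m) (sqr_bound_jensen _ _ l0 r0 lr)
    (fun k => coef_e_ge0 _ _ _ _ _ _ rho_ge0 rho_lt1 g W m k).
  under [X in _ -> X + _ <= _]eq_bigr do rewrite !mxE.
  move=> ele; have := lerD (ler_wpM2l lge (px m)) (ler_wpM2l rge (py m)).
  rewrite -mulrDl lr mul1r => /(le_trans _); apply.
  by rewrite !mulrDr addrACA -mulrDl lr mul1r lerD2r.
- have := lerD (ler_wpM2l lge (bx p)) (ler_wpM2l rge (by_ p)).
  have -> : (l *: x + r *: y).2 p = l * x.2 p + r * y.2 p by rewrite !ffunE.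
  move=> /(le_trans _); apply.
  apply: le_trans (cnorm_convex _ _ _ _ lge rge).
  (* The argument of [cnorm] is linear in the first component of the variables, so the two sides
     agree. *)
  rewrite le_eqVlt; apply/orP; left; apply/eqP; congr cnorm.
  rewrite !mulr_sumr -big_split; apply: eq_bigr => m _ /=.
  by rewrite !mxE rmorphD !rmorphM /=; ring.
- by rewrite !mxE addr_ge0 // mulr_ge0.
Qed.

End Problem.

Theorem lemma1 (R : realType) (M K N L : nat)
  (M_gt0 : (0 < M)%N) (K_gt0 : (0 < K)%N) (N_gt0 : (0 < N)%N) (L_gt0 : (0 < L)%N)
  (rho : R) (rho_ge0 : 0 <= rho) (rho_lt1 : rho < 1)
  (g : 'I_M -> 'I_K -> 'cV[R[i]]_L)
  (C : 'I_M -> 'I_K -> 'M[R[i]]_L)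
  (C_nonneg : forall m k, nonneg_definite (C m k))
  (W : 'I_M -> 'M[R[i]]_(N, L))
  (sigma_m : 'I_M -> R) (sigma_m_ge0 : forall m, 0 <= sigma_m m)
  (sigma_d P_d : R) (sigma_d_gt0 : 0 < sigma_d ^+ 2) (P_d_gt0 : 0 < P_d) :
  quasiconcave_maximization
    (domain (R := R) (M := M) (K := K))
    (objective rho g C sigma_m sigma_d K_gt0)
    (feasible rho g W sigma_m P_d).
Proof.
split; last exact: feasible_convex.
- by move=> z [].
- apply: (quasiconcave_on_bigmin _ _ _ (sinr rho g C sigma_m sigma_d)) => k.
  exact: sinr_quasiconcave.
Qed.
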